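(* Let $H$ and $\tilde H$ be arbitrary pair-interaction Hamiltonians on $(\mathbb{C}^d)^{\otimes n}$ with $J$-matrices $J=(J_{kl})_{k,l=1,\dots,n}$ and $\tilde J=(\tilde J_{kl})_{k,l=1,\dots,n}$ (block matrices), and let $\tau>0$. A necessary condition that $\tilde H$ can be simulated with overhead $\tau$ by $H$ (up to local terms) is that the spectrum of $\tilde J$ is majorized by the spectrum of $\tau J$, i.e. $\mathrm{Spec}(\tilde J)\prec\mathrm{Spec}(\tau J)$. Furthermore, it is necessary that this majorization criterion is still satisfied after rescaling the couplings as follows: for an arbitrary real symmetric $n\times n$-matrix $S=(s_{kl})$, the matrices $J'$ and $\tilde J'$ with blocks $J'_{kl}:=s_{kl}J_{kl}$ and $\tilde J'_{kl}:=s_{kl}\tilde J_{kl}$ satisfy $\mathrm{Spec}(\tilde J')\prec\mathrm{Spec}(\tau J')$.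
   Context: Put $m=d^2-1$ and let $\{\sigma_\alpha\mid\alpha=1,\dots,m\}$ be an orthogonal basis of the real vector space of traceless Hermitian operators on $\mathbb{C}^d$ (with respect to the trace inner product). Let $\sigma^k_\alpha$ be the operator on $(\mathbb{C}^d)^{\otimes n}$ acting as $\sigma_\alpha$ on the $k$-th tensor factor (node) and as the identity elsewhere. A pair-interaction Hamiltonian is an operator $$H=\sum_{k\neq l}\sum_{\alpha,\beta}J_{kl;\alpha\beta}\,\sigma^k_\alpha\sigma^l_\beta+\sum_{k}\sum_\alpha r_{k;\alpha}\,\sigma^k_\alpha$$ with real coefficients and $J_{kl;\alpha\beta}=J_{lk;\beta\alpha}$. Its $J$-matrix is the real symmetric $mn\times mn$ block matrix with $m\times m$ blocks $J_{kl}=(J_{kl;\alpha\beta})_{\alpha\beta}$ for $k\ne l$ (so $J_{lk}=J_{kl}^T$) and $J_{kk}=0$. A local unitary is $U=V_1\otimes\cdots\otimes V_n$ with $V_k\in SU(d)$. $\tilde H$ can be simulated by $H$ with overhead $\tau$ (up to local terms) if there are finitely many $\tau_j>0$ with $\sum_j\tau_j=\tau$ and local unitaries $U_j$ such that $\tilde H-\sum_j\tau_jU_j^\dagger HU_j$ is a sum of operators each acting non-trivially on only one node. $\mathrm{Spec}(X)$ denotes the vector of eigenvalues (with multiplicity) of a Hermitian matrix $X$. For $x,y\in\mathbb{R}^D$ with non-increasing rearrangements $x^\downarrow,y^\downarrow$, $x\prec y$ ($x$ is majorized by $y$) means $\sum_{j=1}^k x^\downarrow_j\le\sum_{j=1}^k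 y^\downarrow_j$ for $k=1,\dots,D-1$ and $\sum_{j=1}^D x^\downarrow_j=\sum_{j=1}^D y^\downarrow_j$.
   Formalization: The orthogonal basis of traceless Hermitian operators is assumed to have elements of one common length; with unequal lengths the claim fails (d=n=2, basis X, Y, εZ with ε<1, H=X⊗X, H̃=Z⊗Z, τ=1). *)

(* Defs.v *)
From mathcomp Require Import all_boot all_order all_algebra.
From mathcomp Require Import sesquilinear spectral reals complex.

Set Implicit Arguments.
Unset Strict Implicit.
Unset Printing Implicit Defensive.

Import Order.TTheory GRing.Theory Num.Theory.
Local Open Scope ring_scope.
Local Open Scope complex_scope.
Local Open Scope sesquilinear_scope.

(* The product basis of (C^d)^{(x) n} is indexed by the configurations
   [{ffun 'I_n -> 'I_d}], enumerated so that operators are square matrices. *)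
Notation tdim d n := #|{ffun 'I_n -> 'I_d}|.

Section Operators.
Variables (R : realType) (d n : nat).

Definition config (x : 'I_(tdim d n)) : {ffun 'I_n -> 'I_d} := enum_val x.

Definition tensor (V : 'I_n -> 'M[R[i]]_d) : 'M[R[i]]_(tdim d n) :=
  \matrix_(x, y) \prod_(k < n) V k (config x k) (config y k).

Definition on_node (k : 'I_n) (A : 'M[R[i]]_d) : 'M[R[i]]_(tdim d n) :=
  tensor (fun l => if l == k then A else 1%:M).

Definition sum_of_local_terms (X : 'M[R[i]]_(tdim d n)) : Prop :=
  exists A : 'I_n -> 'M[R[i]]_d, X = \sum_(k < n) on_node k (A k).

Definition special_unitary (V : 'M[R[i]]_d) : Prop :=
  V \is unitarymx /\ \det V = 1.

Definition local_unitary (U : 'M[R[i]]_(tdim d n)) : Prop :=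
  exists2 V : 'I_n -> 'M[R[i]]_d,
    forall k, special_unitary (V k) & U = tensor V.

Definition simulates (H Ht : 'M[R[i]]_(tdim d n)) (tau : R) : Prop :=
  exists (N : nat) (t : 'I_N -> R) (U : 'I_N -> 'M[R[i]]_(tdim d n)),
    [/\ forall j, 0 < t j,
        \sum_(j < N) t j = tau,
        forall j, local_unitary (U j)
      & sum_of_local_terms
          (Ht - \sum_(j < N) (t j)%:C *: ((U j)^t* *m H *m U j))].

End Operators.

Notation su_dim d := (d ^ 2 - 1)%N.

(* The basis elements are normalised to a common length [c] (e.g. Pauli or
   Gell-Mann matrices): if their lengths differed, conjugation by V in SU(d)
   would not act orthogonally on coefficient vectors, and J-matrices of locally
   equivalent Hamiltonians could have different spectra.
   Linear independence follows from orthogonality. *)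
Definition orthogonal_basis (R : realType) (d : nat)
    (sigma : 'I_(su_dim d) -> 'M[R[i]]_d) : Prop :=
  [/\ forall a, sigma a \is hermsymmx,
      forall a, \tr (sigma a) = 0,
      exists2 c : R, 0 < c &
        forall a b, \tr ((sigma a)^t* *m sigma b) = if a == b then c%:C else 0
    & forall A : 'M[R[i]]_d, A \is hermsymmx -> \tr A = 0 ->
        exists x : 'I_(su_dim d) -> R, A = \sum_a (x a)%:C *: sigma a].

Section PairInteraction.
Variables (R : realType) (d n : nat).
Implicit Type J : 'I_n -> 'I_n -> 'M[R]_(su_dim d).

(* The diagonal blocks [J k k] are ignored here and in [pair_hamiltonian] and
   [J_matrix]: only the couplings with [k != l] are part of the data. *)
Definition symmetric_couplings J : Prop :=
  forall k l, k != l -> J l k = (J k l)^T.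

Definition pair_hamiltonian (sigma : 'I_(su_dim d) -> 'M[R[i]]_d)
    J (r : 'I_n -> 'I_(su_dim d) -> R) : 'M[R[i]]_(tdim d n) :=
  \sum_(k < n) \sum_(l < n | k != l) \sum_a \sum_b
     (J k l a b)%:C *: (on_node k (sigma a) *m on_node l (sigma b))
  + \sum_(k < n) \sum_a (r k a)%:C *: on_node k (sigma a).

Definition J_matrix J : 'M[R]_(\sum_(k < n) su_dim d) :=
  \mxblock_(k < n, l < n) (if k == l then 0 else J k l).

Definition rescale (S : 'M[R]_n) J : 'I_n -> 'I_n -> 'M[R]_(su_dim d) :=
  fun k l => S k l *: J k l.

End PairInteraction.

Section Majorization.
Variable R : realType.

(* Meaningful for Hermitian [X], whose eigenvalues are real; the order of the
   entries is unspecified. *)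
Definition Spec (D : nat) (X : 'M[R[i]]_D) : 'rV[R]_D :=
  map_mx (@complex.Re R) (spectral_diag X).

Lemma char_poly_Spec (D : nat) (X : 'M[R[i]]_D) : X \is hermsymmx ->
  char_poly X = \prod_(j < D) ('X - ((Spec X 0 j)%:C)%:P).
Proof.
move=> Xherm; have /orthomx_spectralP XE := hermitian_normalmx Xherm.
set P := spectralmx X in XE; set s := spectral_diag X in XE.
have Punit : P \in unitmx by exact: spectral_unit.
have PVP : map_mx (@polyC _) (invmx P) *m map_mx (@polyC _) P = 1%:M.
  by rewrite -map_mxM mulVmx // map_mx1.
have sE j : s 0 j = (Spec X 0 j)%:C.
  rewrite mxE; have /mxOverP/(_ 0 j) := hermitian_spectral_diag_real Xherm.
  by move=> /complex_realP[x ->].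
have -> : char_poly X = char_poly (diag_mx s).
  rewrite /char_poly /char_poly_mx [in LHS]XE !map_mxM.
  rewrite -[in LHS](mulmx1 'X%:M) -[in LHS]PVP mulmxA -scalar_mxC.
  by rewrite -mulmxBl -mulmxBr !det_mulmx mulrAC -det_mulmx PVP det1 mul1r.
rewrite char_poly_trig; last exact: diag_mx_is_trig.
by apply: eq_bigr => j _; rewrite mxE eqxx mulr1n sE.
Qed.

Definition decreasing (D : nat) (x : 'rV[R]_D) : seq R :=
  sort >=%R [seq x 0 j | j <- enum 'I_D].

Definition majorized (D : nat) (x y : 'rV[R]_D) : Prop :=
  (forall k, (0 < k < D)%N ->
     \sum_(j < k) (decreasing x)`_j <= \sum_(j < k) (decreasing y)`_j) /\
  \sum_(j < D) x 0 j = \sum_(j < D) y 0 j.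

End Majorization.

Notation complexify := (map_mx (real_complex _)).

(* Main.v *)
(* Conjugating [sigma a] by a unitary [V] acts on coefficient vectors by an
   orthogonal matrix [O].  Traces against [sigma^k_a sigma^l_b] with [k != l]
   kill local terms and return the couplings up to a nonzero factor, so a
   simulation of [Ht] by [H] forces [Jt k l = \sum_j t j O_jk (J k l) O_jl^T]:
   the J-matrix of [Ht] is a positive combination of conjugates of that of [H]
   by block diagonal orthogonal matrices.  Rescaling the blocks by scalars
   commutes with these conjugations.  Finally, if [B] is a convex combination
   of the unitary conjugates of [A] by [U j] with weights [p j], then in
   eigenbases of [A] and [B], where [U j] becomes [W j], the spectrum of [B] is
   the image of that of [A] under the bistochastic matrix
   [\sum_j p j |W j i l|^2], hence is majorized by it. *)
From HB Require Import structures.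
Require Import Defs.
From mathcomp Require Import all_boot all_order all_algebra all_fingroup.
From mathcomp Require Import sesquilinear spectral reals complex.

Set Implicit Arguments.
Unset Strict Implicit.
Unset Printing Implicit Defensive.

Import Order.TTheory GRing.Theory Num.Theory.
Local Open Scope ring_scope.
Local Open Scope complex_scope.
Local Open Scope sesquilinear_scope.

(** * Majorization by bistochastic matrices *)

Section Majorization.
Variable R : realType.

(** Compare [w] with the indicator of the first [k] indices. Both have total [k], so [z] may be
    shifted by the threshold value [zk] without changing the difference of the two sums; then each
    term is a product of two factors of equal sign. *)
Lemma weighted_sum_le (D k : nat) (z w : 'I_D -> R) : (k < D)%N ->
  (forall i j : 'I_D, (i <= j)%N -> z j <= z i) ->
  (forall j, 0 <= w j <= 1) -> \sum_j w j = k%:R ->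
  \sum_j w j * z j <= \sum_(j < D | (j < k)%N) z j.
Proof.
move=> ltkD z_dec w01 sum_w; pose zk := z (Ordinal ltkD).
have ind_sum : \sum_(j < D) (j < k)%N%:R = k%:R :> R.
  transitivity (\sum_(j < D | (j < k)%N) (1 : R)).
    by rewrite [RHS]big_mkcond; apply: eq_bigr => j _; case: ifP.
  by rewrite -(big_ord_widen _ (fun=> 1) (ltnW ltkD)) sumr_const card_ord.
rewrite [leRHS]big_mkcond -subr_ge0 -sumrB.
rewrite (eq_bigr (fun j : 'I_D => ((j < k)%N%:R - w j) * (z j - zk)
    + ((j < k)%N%:R - w j) * zk)) => [|j _]; last first.
  by rewrite -mulrDr subrK mulrBl; case: (j < k)%N; rewrite ?mul1r ?mul0r.
rewrite big_split /= -mulr_suml sumrB sum_w ind_sum subrr mul0r addr0.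
apply: sumr_ge0 => j _; have /andP[w0 w1] := w01 j.
have [ltjk|lekj] := ltnP j k.
  by apply: mulr_ge0; rewrite subr_ge0 // z_dec //= ltnW.
by apply: mulr_le0; [rewrite sub0r oppr_le0 | rewrite subr_le0 z_dec].
Qed.

Lemma decreasing_perm (D : nat) (x : 'rV[R]_D) :
  exists s : 'S_D, forall j : 'I_D, (decreasing x)`_j = x 0 (s j).
Proof.
have /tuple_permP[s sE] : perm_eq (decreasing x) [tuple x 0 j | j < D].
  by rewrite perm_sort.
exists s => j; rewrite sE.
by rewrite (nth_map j) ?size_enum_ord // nth_ord_enum tnth_mktuple.
Qed.

Lemma decreasing_nth_le (D : nat) (x : 'rV[R]_D) (i j : 'I_D) :
  (i <= j)%N -> (decreasing x)`_j <= (decreasing x)`_i.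
Proof.
move=> leij; have szD : size (decreasing x) = D.
  by rewrite size_sort size_map size_enum_ord.
apply: (sorted_leq_nth ge_trans ge_refl) => //; rewrite ?inE ?szD //.
by apply: sort_sorted => a b; rewrite /= real_leVge ?num_real.
Qed.

(** The sum of the [k] largest entries of [y] is a weighted sum of the entries of [x]. The weights
    are partial column sums of [M], hence lie in [0,1], and by the row sums they add up to [k]. *)
Lemma majorized_bistochastic (D : nat) (M : 'M[R]_D) (x y : 'rV[R]_D) :
  (forall i l, 0 <= M i l) -> (forall i, \sum_l M i l = 1) ->
  (forall l, \sum_i M i l = 1) -> (forall i, y 0 i = \sum_l M i l * x 0 l) ->
  majorized y x.
Proof.
move=> M_ge0 M_row M_col yE; split; last first.
  under eq_bigr do rewrite yE; rewrite exchange_big /=.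
  by under eq_bigr do rewrite -mulr_suml M_col mul1r.
move=> k /andP[_ ltkD]; have [s sE] := decreasing_perm x.
have [s' s'E] := decreasing_perm y.
rewrite !(big_ord_widen _ (fun j => (decreasing _)`_j) (ltnW ltkD)).
(* Sorting [y] permutes the rows of [M] by [s'], and sorting [x] permutes its columns by [s]. *)
under eq_bigr do rewrite s'E yE (reindex_inj (@perm_inj _ s)) /=.
rewrite exchange_big /=; under eq_bigr do rewrite -mulr_suml -sE.
apply: weighted_sum_le => //; first exact: decreasing_nth_le.
  move=> l; rewrite sumr_ge0 //= -(M_col (s l)) [leRHS](reindex_inj (@perm_inj _ s')).
  by rewrite [leRHS](bigID (fun i : 'I_D => (i < k)%N)) /= lerDl sumr_ge0.
rewrite exchange_big /=.
have row_s i : \sum_l M (s' i) (s l) = 1.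
  by rewrite -(M_row (s' i)) [RHS](reindex_inj (@perm_inj _ s)).
under eq_bigr do rewrite row_s.
by rewrite -(big_ord_widen _ (fun=> 1) (ltnW ltkD)) sumr_const card_ord.
Qed.

End Majorization.

(** * Adjoints and Hermitian matrices *)

Lemma adjmx_mul (C : numClosedFieldType) (m n p : nat)
    (A : 'M[C]_(m, n)) (B : 'M[C]_(n, p)) : (A *m B)^t* = B^t* *m A^t*.
Proof. by rewrite trmx_mul map_mxM. Qed.

Lemma hermsymmxP (C : numClosedFieldType) (n : nat) (A : 'M[C]_n) :
  reflect (A = A^t*) (A \is hermsymmx).
Proof. by apply: (iffP (is_hermitianmxP _ _ _)); rewrite expr0 scale1r. Qed.

Lemma adjmx_unitary (C : numClosedFieldType) (n : nat) (A : 'M[C]_n) :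
  A \is unitarymx -> A^t* \is unitarymx.
Proof. by rewrite trmxC_unitary. Qed.

(** * Spectra of mixtures of unitary conjugates *)

Section Spectra.
Variable R : realType.
Implicit Type D : nat.

(** The squared modulus, typed in [R] so that it can serve as an entry of a real bistochastic
    matrix. *)
Definition normsq (z : R[i]) : R := complex.Re z ^+ 2 + complex.Im z ^+ 2.

Lemma normsqE (z : R[i]) : (normsq z)%:C = z * (z^*)%R.
Proof. by rewrite add_Re2_Im2 normCK. Qed.

Lemma normsq_ge0 (z : R[i]) : 0 <= normsq z.
Proof. by rewrite addr_ge0 ?sqr_ge0. Qed.

Lemma unitary_row_normsq D (W : 'M[R[i]]_D) (i : 'I_D) :
  W \is unitarymx -> \sum_l normsq (W i l) = 1.
Proof.
move=> /unitarymxP /matrixP/(_ i i); rewrite !mxE eqxx => WW.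
apply: (@complexI R); rewrite rmorph_sum /= -[RHS]WW.
by apply: eq_bigr => l _; rewrite normsqE !mxE.
Qed.

Lemma unitary_col_normsq D (W : 'M[R[i]]_D) (l : 'I_D) :
  W \is unitarymx -> \sum_i normsq (W i l) = 1.
Proof.
rewrite -trmx_unitary => Wtu; rewrite -(unitary_row_normsq l Wtu).
by apply: eq_bigr => i _; rewrite mxE.
Qed.

Lemma hermsym_spectralE D (A : 'M[R[i]]_D) : A \is hermsymmx ->
  exists2 P : 'M[R[i]]_D, P \is unitarymx &
    A = P^t* *m diag_mx (complexify (Spec A)) *m P.
Proof.
move=> Aherm; have Pu := spectral_unitarymx A; exists (spectralmx A) => //.
have -> : complexify (Spec A) = spectral_diag A.
  apply/rowP => j; rewrite !mxE RRe_real //.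
  exact: (mxOverP (hermitian_spectral_diag_real Aherm)).
rewrite -(invmx_unitary Pu).
by have /orthomx_spectralP := hermitian_normalmx Aherm.
Qed.

Lemma majorized_unitary_mixture D N (A B : 'M[R[i]]_D) (p : 'I_N -> R)
    (U : 'I_N -> 'M[R[i]]_D) :
  A \is hermsymmx -> B \is hermsymmx -> (forall j, 0 <= p j) ->
  \sum_j p j = 1 -> (forall j, U j \is unitarymx) ->
  B = \sum_j (p j)%:C *: ((U j)^t* *m A *m U j) ->
  majorized (Spec B) (Spec A).
Proof.
move=> /hermsym_spectralE[P Pu AE] /hermsym_spectralE[Q Qu BE] p_ge0 sum_p Uu.
set x := Spec A in AE *; set y := Spec B in BE * => Bmix.
(* The adjoint of [U j], read from the eigenbasis of [A] to that of [B]. *)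
pose W j := Q *m (U j)^t* *m P^t*.
have Wu j : W j \is unitarymx :=
  mul_unitarymx (mul_unitarymx Qu (adjmx_unitary (Uu j))) (adjmx_unitary Pu).
have diagE : diag_mx (complexify y)
    = \sum_j (p j)%:C *: (W j *m diag_mx (complexify x) *m (W j)^t*).
  transitivity (Q *m B *m Q^t*).
    by rewrite {1}BE !mulmxA (unitarymxP Qu) mul1mx mulmxtVK.
  rewrite Bmix mulmx_sumr mulmx_suml; apply: eq_bigr => j _.
  by rewrite -scalemxAr -scalemxAl AE /W !adjmx_mul !trmxCK !mulmxA.
pose M : 'M[R]_D := \matrix_(i, l) \sum_j p j * normsq (W j i l).
apply: (@majorized_bistochastic _ _ M) => [i l|i|l|i].
- by rewrite mxE sumr_ge0 // => j _; rewrite mulr_ge0 ?normsq_ge0.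
- under eq_bigr do rewrite mxE; rewrite exchange_big /= -sum_p.
  by apply: eq_bigr => j _; rewrite -mulr_sumr (unitary_row_normsq _ (Wu j)) mulr1.
- under eq_bigr do rewrite mxE; rewrite exchange_big /= -sum_p.
  by apply: eq_bigr => j _; rewrite -mulr_sumr (unitary_col_normsq _ (Wu j)) mulr1.
(* The relation between the spectra is the diagonal part of [diagE]. *)
apply: (@complexI R); rewrite rmorph_sum /=.
have /matrixP/(_ i i) := diagE; rewrite !mxE eqxx mulr1n => ->.
rewrite summxE; under [RHS]eq_bigr do rewrite mxE mulr_suml rmorph_sum /=.
rewrite exchange_big /=; apply: eq_bigr => j _; rewrite mul_mx_diag !mxE mulr_sumr.
apply: eq_bigr => l _; rewrite !mxE !rmorphM /= normsqE.
by rewrite mulrAC !mulrA.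
Qed.

End Spectra.

(** Cyclicity of the trace moves the conjugation off [H]; the inner [V *m U] cancels, so [A] and [B]
    are conjugated separately. *)
Lemma mxtrace_conj_mul (F : comNzRingType) (n : nat) (U V A B H : 'M[F]_n) :
  V *m U = 1%:M ->
  \tr (A *m B *m (V *m H *m U)) = \tr (U *m A *m V *m (U *m B *m V) *m H).
Proof.
move=> VU; rewrite !mulmxA [LHS]mxtrace_mulC !mulmxA.
by rewrite -(mulmxA _ V U) VU mulmx1.
Qed.

(** * Tensor products, one-node operators and their traces *)

Section Tensor.
Variables (R : realType) (d n : nat).
Implicit Types (V W : 'I_n -> 'M[R[i]]_d) (A B C E : 'M[R[i]]_d) (k l p q : 'I_n).

(** Summing over configurations instead of their enumeration makes distributivity of products over
    sums applicable. *)
Lemma sum_config (F : {ffun 'I_n -> 'I_d} -> R[i]) :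
  \sum_x F (config x) = \sum_f F f.
Proof. by rewrite [RHS](reindex (@config d n)) //; apply/onW_bij/enum_val_bij. Qed.

Lemma eq_tensor V W : V =1 W -> tensor V = tensor W.
Proof.
by move=> VW; apply/matrixP => x y; rewrite !mxE; apply: eq_bigr => k _; rewrite VW.
Qed.

Lemma tensor_mul V W : tensor V *m tensor W = tensor (fun k => V k *m W k).
Proof.
apply/matrixP => x z; rewrite !mxE.
under eq_bigr do rewrite !mxE -big_split /=.
pose F k i := V k (config x k) i * W k i (config z k).
rewrite (sum_config (fun f => \prod_k F k (f k))) -(bigA_distr_bigA F).
by apply: eq_bigr => k _; rewrite mxE.
Qed.

Lemma tensor1 : tensor (fun=> 1%:M : 'M[R[i]]_d) = 1%:M :> 'M_(tdim d n).
Proof.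
apply/matrixP => x y; rewrite !mxE; have [<-|neq_xy] := eqVneq x y.
  by rewrite big1 // => k _; rewrite mxE eqxx.
have [k neq_k] : exists k, config x k != config y k.
  apply/existsP; rewrite -negb_forall; apply: contra_neqN neq_xy.
  by move=> /forallP eq_xy; apply: enum_val_inj; apply/ffunP => k; apply/eqP.
by rewrite (bigD1 k) //= mxE (negPf neq_k) mul0r.
Qed.

Lemma tensor_adj V : (tensor V)^t* = tensor (fun k => (V k)^t*).
Proof.
by apply/matrixP => x y; rewrite !mxE rmorph_prod; apply: eq_bigr => k _; rewrite !mxE.
Qed.

Lemma tr_tensor V : \tr (tensor V) = \prod_k \tr (V k).
Proof.
transitivity (\sum_x \prod_k V k (config x k) (config x k)).
  by apply: eq_bigr => x _; rewrite mxE.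
rewrite (sum_config (fun f => \prod_k V k (f k) (f k))).
by rewrite -(bigA_distr_bigA (fun k i => V k i i)).
Qed.

Lemma on_node_sum (I : finType) (k : 'I_n) (x : I -> R[i]) (A : I -> 'M[R[i]]_d) :
  on_node k (\sum_a x a *: A a) = \sum_a x a *: on_node k (A a).
Proof.
apply/matrixP => u v; rewrite summxE mxE (bigD1 k) //= eqxx summxE mulr_suml.
apply: eq_bigr => a _; rewrite !mxE [in RHS](bigD1 k) //= eqxx -mulrA.
congr (_ * (_ * _)).
by apply: eq_bigr => l /negPf ->.
Qed.

Lemma on_node_conj V k A : (forall l, V l \is unitarymx) ->
  tensor V *m on_node k A *m (tensor V)^t* = on_node k (V k *m A *m (V k)^t*).
Proof.
move=> Vu; rewrite tensor_adj !tensor_mul; apply: eq_tensor => l.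
by case: eqP => [->//|_]; rewrite mulmx1; apply/unitarymxP.
Qed.

Lemma on_nodeC k l A B : k != l ->
  on_node k A *m on_node l B = on_node l B *m on_node k A.
Proof.
move=> neq_kl; rewrite !tensor_mul; apply: eq_tensor => q.
case: (eqVneq q k) => [->|_]; first by rewrite (negPf neq_kl) mul1mx mulmx1.
by rewrite mul1mx mulmx1.
Qed.

(** The node [p] cannot equal both [k] and [l], so [A] or [B] stands alone at its node and
    contributes a vanishing trace. *)
Lemma tr_pair_local k l p A B C : k != l -> \tr A = 0 -> \tr B = 0 ->
  \tr (on_node k A *m on_node l B *m on_node p C) = 0.
Proof.
move=> neq_kl trA trB; rewrite !tensor_mul tr_tensor.
have [eq_pk|neq_pk] := eqVneq p k.
  rewrite (bigD1 l) //= eqxx eq_pk [l == k]eq_sym (negPf neq_kl).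
  by rewrite mul1mx mulmx1 trB mul0r.
rewrite (bigD1 k) //= eqxx (negPf neq_kl) [k == p]eq_sym (negPf neq_pk).
by rewrite !mulmx1 trA mul0r.
Qed.

(** One of [k] and [l] lies outside {[p], [q]}, and the traceless factor there stands alone. *)
Lemma tr_pair_other k l p q A B C E : k != l -> p != q ->
  (p, q) != (k, l) -> (p, q) != (l, k) -> \tr A = 0 -> \tr B = 0 ->
  \tr (on_node k A *m on_node l B *m (on_node p C *m on_node q E)) = 0.
Proof.
rewrite !xpair_eqE !negb_and => neq_kl neq_pq neq1 neq2 trA trB.
rewrite !tensor_mul tr_tensor.
have [/andP[nkp nkq]|] := boolP ((k != p) && (k != q)).
  rewrite (bigD1 k) //= eqxx (negPf neq_kl) (negPf nkp) (negPf nkq).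
  by rewrite !mulmx1 trA mul0r.
rewrite negb_and !negbK => kpq.
(* Here [k] is one of [p], [q]; if [l] were the other one, ([p], [q]) would be one of the two
   excluded pairs. *)
have /andP[nlp nlq] : (l != p) && (l != q).
  have nlk : l != k by rewrite eq_sym.
  case/orP: kpq => /eqP eqk; rewrite -eqk in neq1 neq2 *.
    by rewrite nlk; move: neq1; rewrite eqxx eq_sym.
  by rewrite nlk andbT; move: neq2; rewrite eqxx orbF eq_sym.
rewrite (bigD1 l) //= eqxx [l == k]eq_sym (negPf neq_kl) (negPf nlp) (negPf nlq).
by rewrite mul1mx !mulmx1 trB mul0r.
Qed.

Lemma tr_pair_same k l A B C E : k != l ->
  \tr (on_node k A *m on_node l B *m (on_node k C *m on_node l E))
  = \tr (A *m C) * \tr (B *m E) * \prod_(q | (q != k) && (q != l)) d%:R.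
Proof.
move=> neq_kl; rewrite !tensor_mul tr_tensor (bigD1 k) //= (bigD1 l) 1?eq_sym //=.
rewrite !eqxx [l == k]eq_sym (negPf neq_kl) mulrA.
rewrite mul1mx !mulmx1 mul1mx; congr (_ * _); apply: eq_bigr => q /andP[/negPf -> /negPf ->].
by rewrite !mulmx1 mxtrace1.
Qed.

End Tensor.

(** * Recovering the couplings from traces *)

Section Couplings.
Variables (R : realType) (d n : nat).
Variable sigma : 'I_(su_dim d) -> 'M[R[i]]_d.
Hypothesis hsigma : orthogonal_basis sigma.
Implicit Types (J : 'I_n -> 'I_n -> 'M[R]_(su_dim d)) (k l : 'I_n).

Lemma basis_dot : exists2 c : R, 0 < c &
  forall a b, \tr (sigma a *m sigma b) = if a == b then c%:C else 0.
Proof.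
have [herm _ [c c_gt0 dot] _] := hsigma; exists c => // a b.
by rewrite -dot -(hermsymmxP _ (herm a)).
Qed.

Definition probe k l (a b : 'I_(su_dim d)) (X : 'M[R[i]]_(tdim d n)) : R[i] :=
  \tr (on_node k (sigma a) *m on_node l (sigma b) *m X).

Lemma probe_is_linear k l a b : linear (probe k l a b : _ -> R[i]^o).
Proof. by move=> x X Y; rewrite /probe mulmxDr -scalemxAr mxtraceD mxtraceZ. Qed.

HB.instance Definition _ k l a b :=
  GRing.isLinear.Build R[i] 'M[R[i]]_(tdim d n) R[i]^o _ (probe k l a b)
    (probe_is_linear k l a b).

Lemma probe_local k l a b X : k != l -> sum_of_local_terms X ->
  probe k l a b X = 0.
Proof.
have [_ tr0 _ _] := hsigma; move=> neq_kl [A ->]; rewrite linear_sum big1 // => p _.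
exact: tr_pair_local.
Qed.

(** The factor [w k l] is twice the square of the common length [c], times [d] for each node other
    than [k] and [l]. The 2 arises because ([k], [l]) and ([l], [k]) both occur in the Hamiltonian
    and contribute equally. Asking for an index in ['I_(su_dim d)] excludes [d = 0], where the
    factor may vanish. *)
Lemma probe_hamiltonian : exists2 w : 'I_n -> 'I_n -> R[i],
  (forall k l, 'I_(su_dim d) -> w k l != 0) &
  forall J r k l a b, symmetric_couplings J -> k != l ->
    probe k l a b (pair_hamiltonian sigma J r) = w k l * (J k l a b)%:C.
Proof.
have [_ tr0 _ _] := hsigma; have [c c_gt0 dot] := basis_dot.
pose v k l := c%:C ^+ 2 * \prod_(q : 'I_n | (q != k) && (q != l)) d%:R.
exists (fun k l => v k l *+ 2) => [k l a|J r k l a b Jsym neq_kl].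
  rewrite mulrn_eq0 mulf_neq0 ?expf_neq0 //; first by rewrite fmorph_eq0 gt_eqF.
  (* By truncated subtraction [su_dim 0] is 0, so the index [a] forces [d] to be nonzero. *)
  have : (0 < su_dim d)%N := leq_ltn_trans (leq0n _) (ltn_ord a).
  by apply: contraTneq => /eqP/prodf_eq0[q _]; rewrite pnatr_eq0 => /eqP ->.
pose F p q := \sum_e \sum_f (J p q e f)%:C * probe k l a b
  (on_node p (sigma e) *m on_node q (sigma f)).
have Fkl : F k l = v k l * (J k l a b)%:C.
  rewrite /F (bigD1 a) //= (bigD1 b) //= !big1 ?addr0 => [|e neq_e|f neq_f].
  - by rewrite /probe tr_pair_same // !dot !eqxx mulrC /v expr2.
  - rewrite big1 // => f _.
    by rewrite /probe tr_pair_same // !dot eq_sym (negPf neq_e) !mul0r mulr0.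
  by rewrite /probe tr_pair_same // !dot [b == f]eq_sym (negPf neq_f) mulr0 mul0r mulr0.
(* Symmetry of the couplings and commutation of operators on distinct nodes identify the two
   orderings. *)
have Flk : F l k = v k l * (J k l a b)%:C.
  have -> : F l k = F k l; last by [].
  rewrite /F exchange_big /=; apply: eq_bigr => e _; apply: eq_bigr => f _.
  by rewrite (Jsym _ _ neq_kl) mxE on_nodeC // eq_sym.
rewrite /pair_hamiltonian linearD /= [X in _ + X](_ : _ = 0) ?addr0; last first.
  rewrite linear_sum big1 //= => p _; rewrite linear_sum big1 //= => e _.
  by rewrite linearZ /= /probe tr_pair_local ?tr0 ?scaler0.
transitivity (\sum_(p < n) \sum_(q < n | p != q) F p q).
  rewrite linear_sum; apply: eq_bigr => p _; rewrite linear_sum; apply: eq_bigr => q _.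
  rewrite linear_sum; apply: eq_bigr => e _; rewrite linear_sum; apply: eq_bigr => f _.
  by rewrite linearZ.
rewrite pair_big_dep (bigD1 (k, l)) //= (bigD1 (l, k)) /=; last first.
  by rewrite eq_sym neq_kl xpair_eqE negb_and eq_sym neq_kl.
rewrite Fkl Flk big1 ?addr0 ?mulr2n ?mulrDl // => -[p q] /= /andP[/andP[neq_pq n1] n2].
rewrite /F big1 // => e _; rewrite big1 // => f _.
by rewrite /probe tr_pair_other ?mulr0.
Qed.

(** The conjugate of [sigma a] is again Hermitian and traceless, so it has real coordinates.
    Conjugation preserves the trace inner product, and since all basis elements share the length
    [c], the coordinate matrix is orthogonal. *)
Lemma basis_conj (V : 'M[R[i]]_d) : V \is unitarymx ->
  exists2 O : 'M[R]_(su_dim d), O *m O^T = 1%:M &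
    forall a, V *m sigma a *m V^t* = \sum_b (O a b)%:C *: sigma b.
Proof.
move=> Vu; have [herm tr0 _ span] := hsigma; have [c c_gt0 dot] := basis_dot.
have VV : V^t* *m V = 1%:M by apply/mulmx1C/unitarymxP.
have /fin_all_exists[x xE] a : exists x : 'I_(su_dim d) -> R,
    V *m sigma a *m V^t* = \sum_b (x b)%:C *: sigma b.
  apply: span; last by rewrite mxtrace_mulC mulmxA VV mul1mx tr0.
  apply/hermsymmxP; rewrite !adjmx_mul trmxCK mulmxA.
  by rewrite -(hermsymmxP _ (herm a)).
pose O : 'M[R]_(su_dim d) := \matrix_(a, b) x a b.
have OE a : V *m sigma a *m V^t* = \sum_b (O a b)%:C *: sigma b.
  by rewrite xE; apply: eq_bigr => b _; rewrite mxE.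
exists O => //; apply/matrixP => a b; rewrite !mxE.
have : \tr (V *m sigma a *m V^t* *m (V *m sigma b *m V^t*)) = \tr (sigma a *m sigma b).
  by rewrite !mulmxA (mulmxKtV _ Vu) // mxtrace_mulC !mulmxA VV mul1mx.
rewrite !OE mulmx_suml dot.
under eq_bigr do rewrite -scalemxAl mulmx_sumr.
rewrite linear_sum /=.
have cC : c%:C != 0 by rewrite fmorph_eq0 gt_eqF.
(* Orthogonality leaves only the terms with equal indices, that is, [c] times an entry of
   [O *m O^T]. *)
rewrite (eq_bigr (fun e => ((O a e * O b e)%:C) * c%:C)) => [|e _]; last first.
  rewrite linearZ /= linear_sum (bigD1 e) //= big1 ?addr0 => [|f neq_f].
    by rewrite -scalemxAr mxtraceZ dot eqxx rmorphM /= mulrA.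
  by rewrite -scalemxAr mxtraceZ dot eq_sym (negPf neq_f) mulr0.
rewrite -mulr_suml => sumE; apply: (@complexI R); rewrite rmorph_sum /=.
apply: (mulIf cC); rewrite -[RHS]/(((a == b)%:R)%:C * c%:C).
have -> : ((a == b)%:R)%:C * c%:C = if a == b then c%:C else 0.
  by case: eqP; rewrite ?mul1r ?mul0r.
by rewrite -sumE; congr (_ * _); apply: eq_bigr => e _; rewrite !mxE.
Qed.

(** Moving the conjugation onto the probe turns [sigma a] into [V k *m sigma a *m (V k)^t*], and
    likewise at node [l]; expanding both in the basis gives the orthogonal matrices. *)
Lemma probe_conj (V : 'I_n -> 'M[R[i]]_d) (O : 'I_n -> 'M[R]_(su_dim d))
    (H : 'M[R[i]]_(tdim d n)) k l a b :
  (forall q, V q \is unitarymx) ->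
  (forall q a, V q *m sigma a *m (V q)^t* = \sum_b (O q a b)%:C *: sigma b) ->
  probe k l a b ((tensor V)^t* *m H *m tensor V)
  = \sum_e \sum_f (O k a e * O l b f)%:C * probe k l e f H.
Proof.
move=> Vu VO; set U := tensor V.
have Uu : U^t* *m U = 1%:M.
  rewrite tensor_adj tensor_mul -tensor1; apply: eq_tensor => q.
  by apply/mulmx1C/unitarymxP.
have -> : probe k l a b (U^t* *m H *m U) =
    \tr ((U *m on_node k (sigma a) *m U^t*) *m (U *m on_node l (sigma b) *m U^t*) *m H).
  exact: mxtrace_conj_mul.
rewrite !on_node_conj // !VO !on_node_sum !mulmx_suml linear_sum.
apply: eq_bigr => e _; rewrite mulmx_sumr mulmx_suml linear_sum /=.
apply: eq_bigr => f _.
by rewrite -scalemxAl -scalemxAr -!scalemxAl !mxtraceZ rmorphM mulrA.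
Qed.

Lemma simulated_couplings J Jt r rt tau :
  symmetric_couplings J -> symmetric_couplings Jt ->
  simulates (pair_hamiltonian sigma J r) (pair_hamiltonian sigma Jt rt) tau ->
  exists N (t : 'I_N -> R) (O : 'I_N -> 'I_n -> 'M[R]_(su_dim d)),
    [/\ forall j, 0 < t j, \sum_j t j = tau,
        forall j k, O j k *m (O j k)^T = 1%:M
      & forall k l, k != l ->
          Jt k l = \sum_j t j *: (O j k *m J k l *m (O j l)^T)].
Proof.
move=> Jsym Jtsym [N [t [U [t_gt0 sum_t Uloc local]]]].
have [w w_neq0 wE] := probe_hamiltonian.
have /fin_all_exists[V VE] j : exists V : 'I_n -> 'M[R[i]]_d,
    (forall k, V k \is unitarymx) /\ U j = tensor V.
  by have [V Vsu ->] := Uloc j; exists V; split=> // k; have [] := Vsu k.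
have /fin_all_exists[O OE] j : exists O : 'I_n -> 'M[R]_(su_dim d),
    forall k, O k *m (O k)^T = 1%:M /\
      forall a, V j k *m sigma a *m (V j k)^t* = \sum_b (O k a b)%:C *: sigma b.
  apply: (@fin_all_exists _ _ (fun k (O : 'M[R]_(su_dim d)) => O *m O^T = 1%:M /\
      forall a, V j k *m sigma a *m (V j k)^t* = \sum_b (O a b)%:C *: sigma b)) => k.
  by have [O] := basis_conj ((VE j).1 k); exists O.
exists N, t, O; split=> // [j k|k l neq_kl]; first by have [] := OE j k.
(* Each entry is compared after multiplication by [w k l], which turns it into a probe of the
   Hamiltonian; the index [a] itself certifies that this factor is nonzero. *)
apply/matrixP => a b; apply: (@complexI R); apply: (mulfI (w_neq0 k l a)).
rewrite -(wE _ rt) //.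
(* The probe does not see the local remainder, so [Ht] and the mixture have equal probes. *)
have /eqP := probe_local a b neq_kl local; rewrite linearB subr_eq0 => /eqP ->.
rewrite linear_sum summxE rmorph_sum mulr_sumr; apply: eq_bigr => j _.
rewrite linearZ /= (VE j).2 (probe_conj _ _ _ _ _ (VE j).1 (fun q => (OE j q).2)).
rewrite !mxE rmorphM /= mulrCA; congr (_ * _).
rewrite rmorph_sum mulr_sumr exchange_big /=; apply: eq_bigr => f _.
rewrite !mxE mulr_suml rmorph_sum mulr_sumr; apply: eq_bigr => e _.
rewrite wE // mulrCA -rmorphM /=; congr (_ * _%:C).
by rewrite mulrAC.
Qed.

End Couplings.

(** * From block couplings to spectra of J-matrices *)

Section JMatrix.
Variables (R : realType) (d n : nat).
Implicit Types (J : 'I_n -> 'I_n -> 'M[R]_(su_dim d)) (S : 'M[R]_n).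

Lemma adjmx_complexify (p q : nat) (A : 'M[R]_(p, q)) :
  (complexify A)^t* = complexify A^T.
Proof. by apply/matrixP => a b; rewrite !mxE; apply: conjc_real. Qed.

Lemma J_matrix_rescale_hermsym J S : symmetric_couplings J -> S^T = S ->
  complexify (J_matrix (rescale S J)) \is hermsymmx.
Proof.
move=> Jsym Ssym; apply/hermsymmxP; rewrite adjmx_complexify tr_mxblock.
congr map_mx; apply: eq_mxblock => k l; rewrite [l == k]eq_sym.
case: eqVneq => [_|neq_kl]; first by rewrite trmx0.
by rewrite /rescale linearZ /= -{2}Ssym mxE -Jsym // eq_sym.
Qed.

(** Block-diagonal conjugation acts on each block separately, so the scalar [S k l] passes through
    it and the zero diagonal blocks stay zero. *)
Lemma J_matrix_rescale_mixture J Jt N (t : 'I_N -> R)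
    (O : 'I_N -> 'I_n -> 'M[R]_(su_dim d)) S :
  (forall k l, k != l -> Jt k l = \sum_j t j *: (O j k *m J k l *m (O j l)^T)) ->
  J_matrix (rescale S Jt) = \sum_j t j *:
    ((\mxdiag_k O j k) *m J_matrix (rescale S J) *m (\mxdiag_k O j k)^T).
Proof.
move=> JtE; pose B j k l := if k == l then 0 else
  t j *: (O j k *m rescale S J k l *m (O j l)^T).
transitivity (\sum_j \mxblock_(k, l) B j k l).
  rewrite -mxblock_sum; apply: eq_mxblock => k l.
  rewrite /B; case: eqVneq => [_|neq_kl]; first by rewrite big1.
  rewrite /rescale JtE // scaler_sumr; apply: eq_bigr => j _.
  by rewrite -scalemxAr -scalemxAl !scalerA mulrC.
apply: eq_bigr => j _.
(* Scaling by [t j] is written as a product with a block-diagonal scalar matrix, so that all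
   products are computed blockwise. *)
rewrite -mul_scalar_mx -mxdiagZ tr_mxdiag mul_mxdiag_mxblock mul_mxblock_mxdiag.
rewrite mul_mxdiag_mxblock; apply: eq_mxblock => k l; rewrite /B mul_scalar_mx.
by case: eqVneq => _; rewrite ?mulmx0 ?mul0mx ?scaler0.
Qed.

Lemma majorized_rescale J Jt N (t : 'I_N -> R)
    (O : 'I_N -> 'I_n -> 'M[R]_(su_dim d)) tau S :
  symmetric_couplings J -> symmetric_couplings Jt -> S^T = S -> 0 < tau ->
  (forall j, 0 < t j) -> \sum_j t j = tau ->
  (forall j k, O j k *m (O j k)^T = 1%:M) ->
  (forall k l, k != l -> Jt k l = \sum_j t j *: (O j k *m J k l *m (O j l)^T)) ->
  majorized (Spec (complexify (J_matrix (rescale S Jt))))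
            (Spec (complexify (tau *: J_matrix (rescale S J)))).
Proof.
move=> Jsym Jtsym Ssym tau_gt0 t_gt0 sum_t OO JtE.
have Jherm := J_matrix_rescale_hermsym Jsym Ssym.
(* Keeping [tau] in the source matrix makes the weights [t j / tau] sum to 1. The transpose appears
   because the mixture has the form [U^t* *m A *m U], whereas the couplings transform as
   [O *m J *m O^T]. *)
apply: (@majorized_unitary_mixture _ _ _ _ _ (fun j => t j / tau)
  (fun j => complexify (\mxdiag_k O j k)^T)).
- apply/hermsymmxP; rewrite adjmx_complexify linearZ /= !map_mxZ.
  by rewrite [in LHS](hermsymmxP _ Jherm) adjmx_complexify.
- exact: J_matrix_rescale_hermsym.
- by move=> j; rewrite divr_ge0 ?ltW.
- by rewrite -mulr_suml sum_t divff ?gt_eqF.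
- move=> j; apply/unitarymxP; rewrite adjmx_complexify trmxK -map_mxM.
  (* The factors are swapped because the hypothesis gives [O *m O^T], not [O^T *m O]. *)
  rewrite (_ : _ *m _ = 1%:M) ?map_mx1 //; apply: mulmx1C.
  rewrite tr_mxdiag mul_mxdiag_mxblock -[RHS]mxdiagZ; apply: eq_mxblock => k l.
  case: eqVneq => [eq_kl|_]; last by rewrite mulmx0.
  by subst l; rewrite !conform_mx_id OO.
rewrite (J_matrix_rescale_mixture S JtE) raddf_sum /=; apply: eq_bigr => j _.
rewrite adjmx_complexify trmxK !map_mxZ !map_mxM /=.
rewrite -scalemxAr -scalemxAl scalerA -rmorphM /= mulrAC -mulrA.
by rewrite divff ?mulr1 ?gt_eqF.
Qed.

End JMatrix.

Theorem theorem3 (R : realType) (d n : nat)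
    (sigma : 'I_(su_dim d) -> 'M[R[i]]_d)
    (hsigma : orthogonal_basis sigma)
    (J Jt : 'I_n -> 'I_n -> 'M[R]_(su_dim d))
    (r rt : 'I_n -> 'I_(su_dim d) -> R)
    (hJ : symmetric_couplings J) (hJt : symmetric_couplings Jt)
    (tau : R) (htau : 0 < tau)
    (hsim : simulates (pair_hamiltonian sigma J r)
                      (pair_hamiltonian sigma Jt rt) tau) :
  majorized (Spec (complexify (J_matrix Jt)))
            (Spec (complexify (tau *: J_matrix J)))
  /\ forall S : 'M[R]_n, S^T = S ->
       majorized (Spec (complexify (J_matrix (rescale S Jt))))
                 (Spec (complexify (tau *: J_matrix (rescale S J)))).
Proof.
have [N [t [O [t_gt0 sum_t OO JtE]]]] := simulated_couplings hsigma hJ hJt hsim.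
have rescaled S : S^T = S ->
    majorized (Spec (complexify (J_matrix (rescale S Jt))))
              (Spec (complexify (tau *: J_matrix (rescale S J)))).
  by move=> Ssym; apply: (majorized_rescale (t := t) (O := O)).
(* The unscaled criterion is the case where [S] is the all-ones matrix. *)
split=> //; have rescale1 K : J_matrix (rescale (const_mx 1) K) = J_matrix K.
  by apply: eq_mxblock => k l; rewrite /rescale mxE scale1r.
by have := rescaled (const_mx 1); rewrite !rescale1 trmx_const; apply.
Qed.
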